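(* (a) The descent number $\mathrm{des}$ is shuffle-compatible. (b) The linear map on $\mathcal{A}_{\mathrm{des}}$ defined by $[\pi]_{\mathrm{des}}\mapsto\binom{p-\mathrm{des}(\pi)+|\pi|-1}{|\pi|}x^{|\pi|}$ is a $\mathbb{Q}$-algebra isomorphism from $\mathcal{A}_{\mathrm{des}}$ to the span of $\{1\}\cup\{\binom{p-j+n-1}{n}x^n\}_{n\ge1,\,0\le j\le n-1}$, a subalgebra of $\mathbb{Q}[p,x]$. (c) $\mathcal{A}_{\mathrm{des}}$ is isomorphic to the span of $\{1\}\cup\{p^jx^n\}_{n\ge1,\,1\le j\le n}$, a subalgebra of $\mathbb{Q}[p,x]$. (d) The linear map on $\mathcal{A}_{\mathrm{des}}$ defined by $[\pi]_{\mathrm{des}}\mapsto\frac{t^{\mathrm{des}(\pi)+1}}{(1-t)^{|\pi|+1}}x^{|\pi|}$ if $|\pi|\ge1$ and $[\pi]_{\mathrm{des}}\mapsto1/(1-t)$ if $|\pi|=0$ is a $\mathbb{Q}$-algebra isomorphism from $\mathcal{A}_{\mathrm{des}}$ to the span of $\{\frac1{1-t}\}\cup\{\frac{t^{j+1}}{(1-t)^{n+1}}x^n\}_{n\ge1,\,0\le j\le n-1}$, a subalgebra of $\mathbb{Q}[[t*]][x]$. (e) For $n\ge1$, the $n$th homogeneous component of $\mathcal{A}_{\mathrm{des}}$ has dimension $n$.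
   Context: A permutation of length $n$ is a sequence $\pi=\pi_1\cdots\pi_n$ of distinct positive integers; $\mathrm{des}(\pi)$ is the number of $i\in[n-1]$ with $\pi_i>\pi_{i+1}$. For disjoint permutations, $S(\pi,\sigma)$ is the set of shuffles (permutations of length $|\pi|+|\sigma|$ containing both as subsequences). A statistic $\mathrm{st}$ is shuffle-compatible if for disjoint $\pi,\sigma$ the multiset $\{\mathrm{st}(\tau):\tau\in S(\pi,\sigma)\}$ depends only on $\mathrm{st}(\pi),\mathrm{st}(\sigma),|\pi|,|\sigma|$; its shuffle algebra $\mathcal{A}_{\mathrm{st}}$ has basis the classes $[\pi]_{\mathrm{st}}$ of permutations with equal length and $\mathrm{st}$-value, product $[\pi]_{\mathrm{st}}[\sigma]_{\mathrm{st}}=\sum_{\tau\in S(\pi,\sigma)}[\tau]_{\mathrm{st}}$, graded by length. In (b), $\binom{p-j+n-1}{n}$ is regarded as a polynomial in $p$. $\mathbb{Q}[[t*]][x]$ denotes polynomials in $x$ with coefficients formal power series in $t$, with multiplication ordinary in $x$ and the Hadamard product $(\sum a_nt^n)*(\sum b_nt^n)=\sum a_nb_nt^n$ in $t$. *)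

(* Defs.v *)
From HB Require Import structures.
From mathcomp Require Import all_boot all_algebra.
From mathcomp Require Import finmap.
From mathcomp Require Import boolp classical_sets functions.
From mathcomp Require Import monalg.

Set Implicit Arguments.
Unset Strict Implicit.
Unset Printing Implicit Defensive.

Import GRing.Theory.
Local Open Scope ring_scope.
Local Open Scope quotient_scope.

Record permutation := Permutation {
  letters :> seq nat;
  _ : uniq letters && all (fun a => 0 < a)%N letters
}.

HB.instance Definition _ := [isSub for letters].
HB.instance Definition _ := [Countable of permutation by <:].

Lemma permutation_uniq (pi : permutation) : uniq pi.
Proof. by case: pi => s /= /andP[]. Qed.

Lemma permutation_gt0 (pi : permutation) a : a \in letters pi -> (0 < a)%N.
Proof. by case: pi => s /= /andP[_ /allP]; apply. Qed.

Definition empty_permutation : permutation :=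
  @Permutation [::] isT.

Definition disjoint_perm (pi sigma : permutation) : bool :=
  ~~ has (mem (letters pi)) (letters sigma).

(* For disjoint pi and sigma this is the set S(pi, sigma): see mem_shuffles
   and shuffles_uniq. *)
Definition shuffles (pi sigma : permutation) : seq permutation :=
  pmap insub [seq s <- permutations (letters pi ++ letters sigma)
             | subseq pi s && subseq sigma s].

Lemma shufflesE pi sigma tau :
  (tau \in shuffles pi sigma) =
  [&& perm_eq tau (letters pi ++ letters sigma),
      subseq pi tau & subseq sigma tau].
Proof. by rewrite mem_pmap_sub mem_filter mem_permutations andbC. Qed.

Lemma shuffles_uniq pi sigma : uniq (shuffles pi sigma).
Proof. by rewrite pmap_sub_uniq// filter_uniq// permutations_uniq. Qed.

Lemma disjoint_cat_uniq pi sigma :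
  disjoint_perm pi sigma -> uniq (letters pi ++ letters sigma).
Proof. by move=> h; rewrite cat_uniq !permutation_uniq andbT. Qed.

Lemma mem_shuffles pi sigma tau : disjoint_perm pi sigma ->
  (tau \in shuffles pi sigma) =
  [&& size tau == (size pi + size sigma)%N,
      subseq pi tau & subseq sigma tau].
Proof.
move=> dj; rewrite shufflesE; apply/and3P/and3P => -[h1 h2 h3]; split=> //.
  by rewrite (perm_size h1) size_cat.
rewrite perm_sym; apply: uniq_perm; [|exact: permutation_uniq|].
  exact: disjoint_cat_uniq.
have [] // := @uniq_min_size _ (letters pi ++ letters sigma) tau.
- exact: disjoint_cat_uniq.
- by move=> a; rewrite mem_cat => /orP[] /(mem_subseq _); apply.
- by rewrite size_cat (eqP h1).
Qed.

Definition same_relative_order (pi sigma : permutation) : Prop :=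
  size pi = size sigma /\
  forall i j, (i < size pi)%N -> (j < size pi)%N ->
    (nth 0 pi i < nth 0 pi j)%N = (nth 0 sigma i < nth 0 sigma j)%N.

(* Invariance under the relative order is part of the notion of a statistic;
   it provides disjoint representatives for any two classes. *)
Record statistic (T : Type) := Statistic {
  stat_fun :> permutation -> T;
  statP : forall pi sigma, same_relative_order pi sigma ->
    stat_fun pi = stat_fun sigma
}.

Definition des_fun (pi : permutation) : nat :=
  #|[pred i : 'I_(size pi).-1 | nth 0 pi i.+1 < nth 0 pi i]|%N.

Lemma des_funP pi sigma :
  same_relative_order pi sigma -> des_fun pi = des_fun sigma.
Proof.
case=> sz h; rewrite /des_fun -sz; apply: eq_card => i.
have lti : (i.+1 < size pi)%N.
  by have := ltn_ord i; rewrite ltn_predRL.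
by rewrite !inE h// ltnW.
Qed.

Definition des : statistic nat := Statistic des_funP.

(* perm_eq on the lists of values is equality of multisets. *)
Definition shuffle_compatible (T : eqType) (st : statistic T) : Prop :=
  forall pi sigma pi' sigma' : permutation,
    disjoint_perm pi sigma -> disjoint_perm pi' sigma' ->
    st pi = st pi' -> st sigma = st sigma' ->
    size pi = size pi' -> size sigma = size sigma' ->
    perm_eq (map st (shuffles pi sigma)) (map st (shuffles pi' sigma')).

Section StatClass.
Variables (T : eqType) (st : statistic T).

Definition stat_equiv : rel permutation :=
  fun pi sigma => (size pi == size sigma) && (st pi == st sigma).

Lemma stat_equiv_class : equiv_class_of stat_equiv.
Proof.
split=> [p|p q|q p r]; rewrite /stat_equiv ?eqxx//.
  by rewrite eq_sym [st p == _]eq_sym.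
by move=> /andP[/eqP-> /eqP->].
Qed.

Canonical stat_equiv_rel := EquivRelPack stat_equiv_class.

Definition stat_class := {eq_quot stat_equiv}%qT.
HB.instance Definition _ := Choice.on stat_class.

Definition stat_class_of (pi : permutation) : stat_class :=
  \pi_({eq_quot stat_equiv}%qT) pi.

Definition stat_class_repr (k : stat_class) : permutation :=
  repr (k : {eq_quot stat_equiv}%qT).

Lemma stat_class_reprK k : stat_class_of (stat_class_repr k) = k.
Proof. exact: reprK. Qed.

Lemma stat_class_eqP pi sigma :
  stat_class_of pi = stat_class_of sigma <->
  size pi = size sigma /\ st pi = st sigma.
Proof.
split=> [/eqmodP/andP[/eqP ? /eqP ?]//|[hs ht]].
by apply/eqmodP; rewrite /= /stat_equiv hs ht !eqxx.
Qed.

End StatClass.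

Definition max_letter (pi : permutation) : nat := \max_(a <- letters pi) a.

Lemma shift_subproof n (pi : permutation) :
  uniq (map (addn n) pi) && all (fun a => 0 < a)%N (map (addn n) pi).
Proof.
rewrite map_inj_uniq ?permutation_uniq; last exact: addnI.
apply/allP => _ /mapP[a /permutation_gt0 a0 ->].
by rewrite addn_gt0 a0 orbT.
Qed.

Definition shift (n : nat) (pi : permutation) : permutation :=
  Permutation (shift_subproof n pi).

Lemma shift_order n pi : same_relative_order (shift n pi) pi.
Proof.
split=> [|i j]; rewrite /= size_map// => hi hj.
by rewrite !(nth_map 0%N)// ltn_add2l.
Qed.

Lemma shift_equiv (T : eqType) (st : statistic T) n pi :
  stat_class_of st (shift n pi) = stat_class_of st pi.
Proof.
apply/stat_class_eqP; split; first by rewrite size_map.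
exact/statP/shift_order.
Qed.

Lemma disjoint_shift n pi sigma :
  (max_letter pi <= n)%N -> disjoint_perm pi (shift n sigma).
Proof.
move=> le_n; apply/hasPn => _ /mapP[b /permutation_gt0 b0 ->].
apply/negP => /= hin.
have : (n + b <= max_letter pi)%N by rewrite /max_letter; apply: leq_bigmax_seq.
by move/leq_trans/(_ le_n); rewrite -{2}[n]addn0 leq_add2l leqNgt b0.
Qed.

Section LinearExtension.
Variables (R : comNzRingType) (K : choiceType) (W : lmodType R) (f : K -> W).

Definition linext (u : {malg R[K]}) : W := \sum_(k <- msupp u) u@_k *: f k.

Lemma linextEw (d : {fset K}) u : (msupp u `<=` d)%fset ->
  linext u = \sum_(k <- d) u@_k *: f k.
Proof.
move=> le; rewrite /linext (big_fset_incl _ le) => //= x xd /mcoeff_outdom ->.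
by rewrite scale0r.
Qed.

Lemma linext_is_linear : linear linext.
Proof.
move=> a u v.
pose d := (msupp u `|` msupp v `|` msupp (a *: u + v))%fset.
have hu : (msupp u `<=` d)%fset by rewrite /d -fsetUA fsubsetUl.
have hv : (msupp v `<=` d)%fset.
  by apply: fsubset_trans (fsubsetUl _ _); apply: fsubsetUr.
rewrite (linextEw hu) (linextEw hv) (@linextEw d) ?fsubsetUr//.
rewrite scaler_sumr -big_split; apply: eq_bigr => k _ /=.
by rewrite mcoeffD mcoeffZ scalerDl scalerA.
Qed.

HB.instance Definition _ :=
  GRing.isLinear.Build R {malg R[K]} W *:%R linext linext_is_linear.

Lemma linextU k : linext (mkmalgU k 1) = f k.
Proof. by rewrite (linextEw (msuppU_le)) big_seq_fset1 mcoeffUU scale1r. Qed.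

End LinearExtension.

Section ShuffleProduct.
Variables (T : eqType) (st : statistic T).

Definition shuffle_space := {malg rat[stat_class st]}.
HB.instance Definition _ := GRing.Lmodule.on shuffle_space.

Definition basis_class (pi : permutation) : shuffle_space :=
  mkmalgU (stat_class_of st pi) 1.

(* Shifting the letters of the second representative makes the two disjoint;
   pclassM below is the product rule for arbitrary disjoint representatives. *)
Definition class_mul (k l : stat_class st) : shuffle_space :=
  let pi := stat_class_repr k in
  let sigma := shift (max_letter pi) (stat_class_repr l) in
  \sum_(tau <- shuffles pi sigma) basis_class tau.

Definition shuffle_mul (u v : shuffle_space) : shuffle_space :=
  linext (fun k => linext (class_mul k) v) u.

Definition shuffle_one : shuffle_space := basis_class empty_permutation.

Lemma basis_class_eq (pi sigma : permutation) :
  size pi = size sigma -> st pi = st sigma ->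
  basis_class pi = basis_class sigma.
Proof. by move=> h1 h2; congr mkmalgU; apply/stat_class_eqP. Qed.

Lemma shuffle_mul_linearl v : linear (shuffle_mul ^~ v).
Proof. exact: linext_is_linear. Qed.

Lemma shuffle_mul_linearr u : linear (shuffle_mul u).
Proof.
move=> a v w; rewrite /shuffle_mul /linext scaler_sumr -big_split/=.
apply: eq_bigr => k _; rewrite -/(linext _ _) linearP/= scalerDr !scalerA.
by rewrite [a * _]mulrC.
Qed.

Lemma shuffle_space_ind (P : shuffle_space -> Prop) :
  (forall pi, P (basis_class pi)) -> P 0 ->
  (forall a u v, P u -> P v -> P (a *: u + v)) -> forall u, P u.
Proof.
move=> hb h0 hl u; rewrite [u]monalgE; elim: (enum_fset _) => [|k s ih].
  by rewrite big_nil.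
rewrite big_cons; have -> : mkmalgU k u@_k = u@_k *: mkmalgU k (1 : rat).
  by apply/malgP => l; rewrite mcoeffZ !mcoeffU mulr_natr.
by apply: hl => //; rewrite -[k]stat_class_reprK; apply: hb.
Qed.

Hypothesis sc : shuffle_compatible st.

Lemma basis_class_sum (pi sigma pi' sigma' : permutation) :
    disjoint_perm pi sigma -> disjoint_perm pi' sigma' ->
    st pi = st pi' -> st sigma = st sigma' ->
    size pi = size pi' -> size sigma = size sigma' ->
  \sum_(tau <- shuffles pi sigma) basis_class tau =
  \sum_(tau <- shuffles pi' sigma') basis_class tau.
Proof.
move=> d d' e1 e2 s1 s2.
set l := shuffles pi sigma; set l' := shuffles pi' sigma'.
pose F v := basis_class (nth pi (l ++ l') (index v (map st (l ++ l')))).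
have szl tau : tau \in l ++ l' -> size tau = (size pi + size sigma)%N.
  rewrite mem_cat !mem_shuffles// -s1 -s2.
  by case/orP => /andP[/eqP].
have FE tau : tau \in l ++ l' -> basis_class tau = F (st tau).
  move=> tl; have lt : (index (st tau) (map st (l ++ l')) < size (l ++ l'))%N.
    by rewrite -(size_map st) index_mem map_f.
  apply: basis_class_eq; first by rewrite (szl tau tl) (szl (nth _ _ _)) ?mem_nth.
  by rewrite -(nth_map pi (st pi) st lt) nth_index// map_f.
transitivity (\sum_(v <- map st l) F v).
  by rewrite big_map; apply: eq_big_seq => tau tl; rewrite FE// mem_cat tl.
rewrite (perm_big _ (sc d d' e1 e2 s1 s2)) big_map.
by apply: eq_big_seq => tau tl; rewrite FE// mem_cat tl orbT.
Qed.

Lemma shuffle_mul_basis pi sigma : disjoint_perm pi sigma ->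
  shuffle_mul (basis_class pi) (basis_class sigma) =
  \sum_(tau <- shuffles pi sigma) basis_class tau.
Proof.
move=> dj; rewrite /shuffle_mul /basis_class !linextU /class_mul.
have [hs ht] : size (stat_class_repr (stat_class_of st pi)) = size pi /\
    st (stat_class_repr (stat_class_of st pi)) = st pi.
  by apply/stat_class_eqP; rewrite stat_class_reprK.
set n := max_letter _.
have [hs' ht'] :
    size (shift n (stat_class_repr (stat_class_of st sigma))) = size sigma /\
    st (shift n (stat_class_repr (stat_class_of st sigma))) = st sigma.
  by apply/stat_class_eqP; rewrite shift_equiv stat_class_reprK.
by apply: basis_class_sum => //; apply: disjoint_shift.
Qed.

Lemma shuffle_linear_eq (f g : shuffle_space -> shuffle_space) :
  linear f -> linear g -> (forall pi, f (basis_class pi) = g (basis_class pi)) ->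
  f =1 g.
Proof.
move=> lf lg fg u; elim/shuffle_space_ind: u => [//||a u v hu hv].
  have := lf (-1) 0 0; have := lg (-1) 0 0.
  by rewrite scaler0 addr0 !scaleN1r !addNr => -> ->.
by rewrite lf lg hu hv.
Qed.

Lemma shuffles_sym pi sigma :
  perm_eq (shuffles pi sigma) (shuffles sigma pi).
Proof.
apply: uniq_perm; rewrite ?shuffles_uniq// => tau.
have /permPr e := permEl (perm_catC (letters pi) (letters sigma)).
by rewrite !shufflesE e [subseq pi _ && _]andbC.
Qed.

Lemma disjoint_sym pi sigma : disjoint_perm pi sigma = disjoint_perm sigma pi.
Proof. by rewrite /disjoint_perm has_sym. Qed.

Lemma shuffle_mulC : commutative shuffle_mul.
Proof.
move=> u v; move: u.
apply: (@shuffle_linear_eq (shuffle_mul ^~ v) (shuffle_mul v)).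
- exact: shuffle_mul_linearl.
- exact: shuffle_mul_linearr.
move=> pi; move: v; apply: (@shuffle_linear_eq (shuffle_mul _) (shuffle_mul ^~ _)).
- exact: shuffle_mul_linearr.
- exact: shuffle_mul_linearl.
move=> sigma; pose sg := shift (max_letter pi) sigma.
have -> : basis_class sigma = basis_class sg.
  by rewrite /basis_class shift_equiv.
have dj : disjoint_perm pi sg by apply: disjoint_shift.
rewrite !shuffle_mul_basis// 1?disjoint_sym//.
exact: perm_big (shuffles_sym _ _).
Qed.

Lemma shuffles0 pi : shuffles empty_permutation pi = [:: pi].
Proof.
apply: perm_small_eq => //; apply: uniq_perm => //; first exact: shuffles_uniq.
move=> tau; rewrite shufflesE inE sub0seq/=.
apply/andP/eqP => [[h1 h2]|->]; last by rewrite perm_refl subseq_refl.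
apply/val_inj/esym/eqP.
by rewrite -(size_subseq_leqif h2) (perm_size h1).
Qed.

Lemma shuffle_mul1 : left_id shuffle_one shuffle_mul.
Proof.
apply: (@shuffle_linear_eq (shuffle_mul _) id) => //.
  exact: shuffle_mul_linearr.
move=> pi; rewrite shuffle_mul_basis ?shuffles0 ?big_seq1//.
by rewrite disjoint_sym.
Qed.

Definition shuffles3 pi sigma rho : seq permutation :=
  [seq ups | tau <- shuffles pi sigma, ups <- shuffles tau rho].

Lemma mem_shuffles3 pi sigma rho ups :
  disjoint_perm pi sigma -> disjoint_perm pi rho -> disjoint_perm sigma rho ->
  (ups \in shuffles3 pi sigma rho) =
  [&& perm_eq ups (letters pi ++ letters sigma ++ letters rho),
      subseq pi ups, subseq sigma ups & subseq rho ups].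
Proof.
move=> d1 d2 d3; apply/allpairsPdep/and4P.
  move=> [tau [ups' [+ + ->]]]; rewrite !shufflesE.
  move=> /and3P[p1 s1 s2] /and3P[p2 s3 s4]; split=> //.
  - by apply: (perm_trans p2); rewrite catA perm_cat2r.
  - exact: subseq_trans s3.
  - exact: subseq_trans s3.
move=> [p s1 s2 s3].
pose t := filter (mem (letters pi ++ letters sigma)) ups.
have ut : uniq t && all (fun a => 0 < a)%N t.
  rewrite filter_uniq ?permutation_uniq//=; apply/allP => a.
  by rewrite mem_filter => /andP[_ /permutation_gt0].
have pt : perm_eq t (letters pi ++ letters sigma).
  rewrite /t; apply: (perm_trans (perm_filter _ p)).
  rewrite catA filter_cat (_ : filter _ (letters rho) = [::]) ?cats0.
    by rewrite (_ : filter _ _ = letters pi ++ letters sigma)//; apply/all_filterP/allP.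
  apply/eqP; rewrite -(negbK (_ == _)) -has_filter; apply/hasPn => a ar /=.
  by rewrite mem_cat negb_or (hasPn d2)// (hasPn d3).
exists (Permutation ut), ups; rewrite !shufflesE/=; split=> //.
  rewrite pt !subseq_filter s1 s2 !andbT.
  by rewrite andTb; apply/andP; split; apply/allP => a /= ha; rewrite mem_cat ha ?orbT.
rewrite filter_subseq s3 !andbT (perm_trans p)// catA perm_cat2r.
by rewrite perm_sym.
Qed.

Lemma shuffles3_uniq pi sigma rho :
  disjoint_perm pi rho -> disjoint_perm sigma rho ->
  uniq (shuffles3 pi sigma rho).
Proof.
move=> d2 d3; apply: allpairs_uniq_dep.
- exact: shuffles_uniq.
- by move=> tau _; apply: shuffles_uniq.
have key tau ups : tau \in shuffles pi sigma -> ups \in shuffles tau rho ->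
    letters tau = filter (mem (letters pi ++ letters sigma)) ups.
  rewrite !shufflesE => /and3P[p1 _ _] /and3P[p2 s2 _].
  apply/eqP; rewrite -(size_subseq_leqif _); last first.
    rewrite subseq_filter s2 andbT; apply/allP => a.
    by rewrite (perm_mem p1).
  rewrite size_filter (permP p2) count_cat.
  have -> : count (mem (letters pi ++ letters sigma)) rho = 0%N.
    apply/eqP; rewrite -leqn0 leqNgt -has_count; apply/hasPn => a ar /=.
    by rewrite mem_cat negb_or (hasPn d2)// (hasPn d3).
  rewrite addn0 eq_sym -all_count; apply/allP => a.
  by rewrite (perm_mem p1).
move=> _ _ /allpairsPdep[t1 [u1 [h1 h1' ->]]] /allpairsPdep[t2 [u2 [h2 h2' ->]]].
move=> /= e; rewrite -{}e in h2' *; congr existT.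
by apply: val_inj; rewrite /= (key _ _ h1 h1') (key _ _ h2 h2').
Qed.

Lemma shuffles3_rot pi sigma rho :
  disjoint_perm pi sigma -> disjoint_perm pi rho -> disjoint_perm sigma rho ->
  perm_eq (shuffles3 pi sigma rho) (shuffles3 sigma rho pi).
Proof.
move=> d1 d2 d3; apply: uniq_perm.
- exact: shuffles3_uniq.
- by apply: shuffles3_uniq; rewrite disjoint_sym.
move=> ups; rewrite !mem_shuffles3 1?[disjoint_perm _ pi]disjoint_sym//.
rewrite (permPr (_ : perm_eq (letters pi ++ _) (letters sigma ++ letters rho ++ letters pi))); last first.
  by rewrite perm_catC -catA.
by congr andb; rewrite andbC -andbA.
Qed.

Lemma disjoint_shuffle pi sigma rho tau :
  tau \in shuffles pi sigma -> disjoint_perm pi rho -> disjoint_perm sigma rho ->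
  disjoint_perm tau rho.
Proof.
rewrite shufflesE => /and3P[p _ _] d1 d2; apply/hasPn => a ar /=.
by rewrite (perm_mem p) mem_cat negb_or (hasPn d1)// (hasPn d2).
Qed.

Lemma shuffle_mul_suml (I : eqType) (r : seq I) (F : I -> shuffle_space) v :
  shuffle_mul (\sum_(i <- r) F i) v = \sum_(i <- r) shuffle_mul (F i) v.
Proof.
elim: r => [|i r ih]; last first.
  rewrite !big_cons -ih -[F i in LHS]scale1r shuffle_mul_linearl.
  by rewrite scale1r.
rewrite !big_nil; have := shuffle_mul_linearl v (-1) 0 0.
by rewrite scaler0 addr0 !scaleN1r !addNr.
Qed.

Lemma shuffle_mul3 pi sigma rho :
  disjoint_perm pi sigma -> disjoint_perm pi rho -> disjoint_perm sigma rho ->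
  shuffle_mul (shuffle_mul (basis_class pi) (basis_class sigma))
              (basis_class rho) =
  \sum_(ups <- shuffles3 pi sigma rho) basis_class ups.
Proof.
move=> d1 d2 d3; rewrite shuffle_mul_basis// shuffle_mul_suml big_allpairs_dep.
apply: eq_big_seq => tau ht; apply: shuffle_mul_basis.
exact: disjoint_shuffle ht _ _.
Qed.

Lemma linear_comp (f g : shuffle_space -> shuffle_space) :
  linear f -> linear g -> linear (f \o g).
Proof. by move=> lf lg a u v; rewrite /= lg lf. Qed.

Lemma shuffle_mulA : associative shuffle_mul.
Proof.
move=> u v w.
have ll := shuffle_mul_linearl; have lr := shuffle_mul_linearr.
have lc := linear_comp.
refine (@shuffle_linear_eq (shuffle_mul ^~ (shuffle_mul v w))
  ((shuffle_mul ^~ w) \o (shuffle_mul ^~ v)) (ll _) (lc _ _ (ll _) (ll _)) _ u).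
move=> pi; refine (@shuffle_linear_eq
  (shuffle_mul (basis_class pi) \o (shuffle_mul ^~ w))
  ((shuffle_mul ^~ w) \o (shuffle_mul (basis_class pi)))
  (lc _ _ (lr _) (ll _)) (lc _ _ (ll _) (lr _)) _ v).
move=> sigma; refine (@shuffle_linear_eq
  (shuffle_mul (basis_class pi) \o shuffle_mul (basis_class sigma))
  (shuffle_mul (shuffle_mul (basis_class pi) (basis_class sigma)))
  (lc _ _ (lr _) (lr _)) (lr _) _ w).
move=> rho /=.
pose n := max_letter pi; pose sg := shift n sigma.
pose m := maxn n (max_letter sg); pose rh := shift m rho.
have -> : basis_class sigma = basis_class sg by rewrite /basis_class shift_equiv.
have -> : basis_class rho = basis_class rh by rewrite /basis_class shift_equiv.
have d1 : disjoint_perm pi sg by apply: disjoint_shift.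
have d2 : disjoint_perm pi rh by apply: disjoint_shift; apply: leq_maxl.
have d3 : disjoint_perm sg rh by apply: disjoint_shift; apply: leq_maxr.
have d1' : disjoint_perm sg pi by rewrite disjoint_sym.
have d2' : disjoint_perm rh pi by rewrite disjoint_sym.
refine (etrans (shuffle_mulC _ _) (etrans (shuffle_mul3 d3 d1' d2') _)).
refine (etrans _ (esym (shuffle_mul3 d1 d2 d3))).
exact/esym/perm_big/shuffles3_rot.
Qed.

Lemma shuffle_one_neq0 : shuffle_one != 0.
Proof. by rewrite /shuffle_one /basis_class monalgU_eq0 oner_neq0. Qed.

Lemma shuffle_mulDl : left_distributive shuffle_mul +%R.
Proof.
by move=> u v w; have := shuffle_mul_linearl w 1 u v; rewrite !scale1r.
Qed.

Lemma shuffle_mul_scalel a u v :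
  a *: shuffle_mul u v = shuffle_mul (a *: u) v.
Proof.
have h0 : shuffle_mul 0 v = 0.
  have := shuffle_mul_linearl v (-1) 0 0.
  by rewrite scaler0 addr0 !scaleN1r !addNr.
have := shuffle_mul_linearl v a u 0.
by rewrite h0 !addr0 => ->.
Qed.

End ShuffleProduct.

(* A_st has the classes of stat_equiv as basis. The argument sc does not affect
   the underlying space; the ring structure depends on it. *)
Definition shuffle_algebra (T : eqType) (st : statistic T)
  (sc : shuffle_compatible st) : Type := shuffle_space st.

Section ShuffleAlgebra.
Variables (T : eqType) (st : statistic T) (sc : shuffle_compatible st).

HB.instance Definition _ := GRing.Lmodule.on (shuffle_algebra sc).
HB.instance Definition _ := GRing.Zmodule_isComNzRing.Build (shuffle_algebra sc)
  (shuffle_mulA sc) (shuffle_mulC sc) (shuffle_mul1 sc)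
  (@shuffle_mulDl T st) (@shuffle_one_neq0 T st).
HB.instance Definition _ :=
  GRing.Lmodule_isLalgebra.Build rat (shuffle_algebra sc)
    (@shuffle_mul_scalel T st).
HB.instance Definition _ :=
  GRing.Lalgebra_isComAlgebra.Build rat (shuffle_algebra sc).

Definition pclass (pi : permutation) : shuffle_algebra sc := basis_class st pi.

Lemma pclassM pi sigma : disjoint_perm pi sigma ->
  pclass pi * pclass sigma = \sum_(tau <- shuffles pi sigma) pclass tau.
Proof. exact: shuffle_mul_basis. Qed.

Lemma pclass_eqP pi sigma :
  pclass pi = pclass sigma <-> size pi = size sigma /\ st pi = st sigma.
Proof.
split=> [|[hs ht]]; last exact: basis_class_eq.
move/(congr1 (mcoeff (stat_class_of st pi))); rewrite !mcoeffU eqxx.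
by case: eqP => // /stat_class_eqP[-> ->].
Qed.

Lemma pclass1 : pclass empty_permutation = 1.
Proof. by []. Qed.

End ShuffleAlgebra.

Section Span.
Variables (R : nzRingType) (V : lmodType R).

Definition lspan (S : set V) : set V :=
  [set v | exists (m : nat) (c : 'I_m -> R) (s : 'I_m -> V),
     (forall i, S (s i)) /\ v = \sum_(i < m) c i *: s i].

Definition has_dimension (W : set V) (m : nat) : Prop :=
  exists b : 'I_m -> V,
    (forall c : 'I_m -> R, \sum_(i < m) c i *: b i = 0 -> forall i, c i = 0) /\
    W = lspan (range b).

End Span.

Definition is_subalgebra (R : nzRingType) (A : algType R) (S : set A) : Prop :=
  GRing.subalg_closed (mem S).

(* phi, with codomain restricted to S, is an algebra isomorphism onto S. *)
Definition iso_onto (R : nzRingType) (A B : algType R)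
  (phi : {lrmorphism A -> B}) (S : set B) : Prop :=
  injective phi /\ range phi = S.

Definition homogeneous_component (T : eqType) (st : statistic T)
  (sc : shuffle_compatible st) (n : nat) : set (shuffle_algebra sc) :=
  lspan [set pclass sc pi | pi in [set pi : permutation | size pi = n]].

Arguments homogeneous_component {T st} sc n.

(* A power series is its sequence of coefficients; ps_mul is the ordinary
   (Cauchy) product, needed to write t^j / (1 - t)^k. *)
Section PowerSeries.

Definition ps_one : nat -> rat := fun n => (n == 0%N)%:R.
Definition ps_mul (a b : nat -> rat) : nat -> rat :=
  fun n => \sum_(i < n.+1) a i * b (n - i)%N.
Definition ps_exp (a : nat -> rat) (k : nat) : nat -> rat :=
  iter k (ps_mul a) ps_one.

Definition ps_t : nat -> rat := fun n => (n == 1%N)%:R.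
Definition ps_1mt : nat -> rat := fun n => ps_one n - ps_t n.
(* 1 / (1 - t) = 1 + t + t^2 + ..., see ps_inv_1mtE *)
Definition ps_inv_1mt : nat -> rat := fun=> 1.

(* t^j / (1 - t)^k, see ps_fracE *)
Definition ps_frac (j k : nat) : nat -> rat :=
  ps_mul (ps_exp ps_t j) (ps_exp ps_inv_1mt k).

Let tr N (a : nat -> rat) : {poly rat} := \poly_(i < N) a i.

Let tr_mul N (p q : {poly rat}) a b :
  (forall i, (i < N)%N -> p`_i = a i) -> (forall i, (i < N)%N -> q`_i = b i) ->
  forall i, (i < N)%N -> (p * q)`_i = ps_mul a b i.
Proof.
move=> hp hq i iN; rewrite coefM; apply: eq_bigr => j _.
rewrite hp ?hq//; first exact: leq_ltn_trans (leq_subr _ _) iN.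
exact: leq_trans (ltn_ord j) iN.
Qed.

Let trE N a i : (i < N)%N -> (tr N a)`_i = a i.
Proof. by move=> iN; rewrite coef_poly iN. Qed.

Lemma ps_mulA : associative ps_mul.
Proof.
move=> a b c; apply/funext => n; have h N d e := tr_mul (@trE N d) (@trE N e).
rewrite -(tr_mul (@trE n.+1 a) (h n.+1 b c))//.
by rewrite mulrA (tr_mul (h n.+1 a b) (@trE n.+1 c)).
Qed.

Lemma ps_mulC : commutative ps_mul.
Proof.
move=> a b; apply/funext => n.
rewrite -(tr_mul (@trE n.+1 a) (@trE n.+1 b))// mulrC.
exact: tr_mul (@trE n.+1 b) (@trE n.+1 a) _ _.
Qed.

Lemma ps_mul1 : left_id ps_one ps_mul.
Proof.
move=> a; apply/funext => n; rewrite /ps_mul big_ord_recl /= subn0 mul1r.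
by rewrite big1 ?addr0// => i _; rewrite mul0r.
Qed.

Lemma ps_inv_1mtE : ps_mul ps_1mt ps_inv_1mt = ps_one.
Proof.
apply/funext => -[|n]; rewrite /ps_mul /ps_1mt /ps_one /ps_t.
  by rewrite big_ord1 /= subr0 mulr1.
rewrite !big_ord_recl big1 => [|i _]; last by rewrite /= subrr mul0r.
by rewrite /= subr0 sub0r !mulr1 addr0 subrr.
Qed.

Lemma ps_fracE j k :
  ps_mul (ps_exp ps_1mt k) (ps_frac j k) = ps_exp ps_t j.
Proof.
rewrite /ps_frac ps_mulA [ps_mul _ (ps_exp ps_t j)]ps_mulC -ps_mulA.
suff -> : ps_mul (ps_exp ps_1mt k) (ps_exp ps_inv_1mt k) = ps_one.
  by rewrite ps_mulC ps_mul1.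
elim: k => [|k ih] /=; first by rewrite ps_mul1.
rewrite -ps_mulA [ps_mul (ps_exp _ _) (ps_mul _ _)]ps_mulA.
rewrite [ps_mul (ps_exp _ _) ps_inv_1mt]ps_mulC -[ps_mul (ps_mul _ _) _]ps_mulA.
by rewrite ih [ps_mul ps_inv_1mt _]ps_mulC ps_mul1 ps_inv_1mtE.
Qed.

End PowerSeries.

(* Q[[t*]]: the ring structure on nat -> rat is pointwise, so that the product
   is the Hadamard product. *)
Definition hseries : Type := nat -> rat.
HB.instance Definition _ := GRing.ComNzRing.copy hseries (nat -> rat).

Lemma hseriesM (a b : hseries) n : (a * b) n = a n * b n.
Proof. by []. Qed.

(* Q[[t*]][x]; the alias carries the Q-algebra structure, whereas {poly hseries}
   is canonically an algebra over hseries. *)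
Definition hseries_poly : Type := {poly hseries}.
HB.instance Definition _ := GRing.ComNzRing.copy hseries_poly {poly hseries}.

Section HseriesPoly.
Implicit Types (q r : rat) (f g : hseries_poly).

Definition hseries_const q : hseries := fun=> q.

Definition hseries_scale q f : hseries_poly :=
  hseries_const q *: (f : {poly hseries}).

Lemma hseries_scaleA q r f :
  hseries_scale q (hseries_scale r f) = hseries_scale (q * r) f.
Proof. exact: scalerA. Qed.

Lemma hseries_scale1 : left_id 1 hseries_scale.
Proof. exact: scale1r. Qed.

Lemma hseries_scaleDr : right_distributive hseries_scale +%R.
Proof. move=> q; exact: scalerDr. Qed.

Lemma hseries_scaleDl f : {morph hseries_scale^~ f : q r / q + r}.
Proof. move=> q r; exact: scalerDl. Qed.

HB.instance Definition _ := GRing.Zmodule_isLmodule.Build rat hseries_poly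
  hseries_scaleA hseries_scale1 hseries_scaleDr hseries_scaleDl.

Lemma hseries_scaleAl q f g : q *: (f * g) = (q *: f) * g.
Proof. exact: scalerAl. Qed.

HB.instance Definition _ :=
  GRing.Lmodule_isLalgebra.Build rat hseries_poly hseries_scaleAl.
HB.instance Definition _ :=
  GRing.Lalgebra_isComAlgebra.Build rat hseries_poly.

Lemma hseries_scaleE q f i n : (q *: f)`_i n = q * f`_i n.
Proof. by rewrite coefZ. Qed.

Definition hmonomial (a : nat -> rat) (n : nat) : hseries_poly :=
  (a : hseries)%:P * 'X^n.

End HseriesPoly.

From mathcomp Require Import mpoly.

Notation "'Q[p,x]'" := {mpoly rat[2]}.

Definition var_p : Q[p,x] := 'X_ord0.
Definition var_x : Q[p,x] := 'X_ord_max.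

(* f (f - 1) ... (f - n + 1) / n! *)
Definition binomial_of (A : algType rat) (f : A) (n : nat) : A :=
  (n`!%:R^-1 : rat) *: \prod_(i < n) (f - i%:R).

(* binom(p - j + n - 1, n) *)
Definition binom_p (j n : nat) : Q[p,x] :=
  binomial_of (var_p - j%:R + n%:R - 1) n.

(* Main.v *)
Require Import Defs.
From HB Require Import structures.
From mathcomp Require Import all_boot all_algebra.
From mathcomp Require Import finmap.
From mathcomp Require Import boolp classical_sets functions.
From mathcomp Require Import mpoly monalg.
From mathcomp Require Import zify ring.

(* For a word w with n letters and d descents, binom(p - d + n - 1, n) counts
   the sequences a_1 <= ... <= a_n with values in {1, ..., p} that increase
   strictly at the descents of w.  Peeling off the smallest value gives a
   recursion for this count, along which one sees that it is multiplicative
   over shuffles.  For fixed n these counts form a unitriangular system in p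
   and d, so the distribution of des over a shuffle set is determined by
   them: this is (a), and also the injectivity in (b) and (d), where
   multiplicativity holds because a polynomial is determined by its values at
   the natural numbers.  The space (c) coincides with that of (b) by the
   identities p b_(j,n) = (j + 1) b_(j,n+1) + (n - j) b_(j+1,n+1) and
   b_(j,n) = b_(j,n+1) - b_(j+1,n+1) for b_(j,n) = binom(p - j + n - 1, n). *)

Set Implicit Arguments.
Unset Strict Implicit.
Unset Printing Implicit Defensive.

Import GRing.Theory Num.Theory.
Local Open Scope ring_scope.

(** * Shuffles of words *)

Section WordShuffle.
Variable T : eqType.
Implicit Types (a b : T) (u v s : seq T).

(** [shuffles] filters a list of rearrangements and offers no recursion; this form recurses on the
    first letters, as [pcount] does. The inner [fix] is there because each call shortens only one of
    the two words. *)
Fixpoint wshuffle u : seq T -> seq (seq T) :=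
  fix wshuffle_u v :=
    match u, v with
    | [::], _ => [:: v]
    | _, [::] => [:: u]
    | a :: u', b :: v' =>
        map (cons a) (wshuffle u' v) ++ map (cons b) (wshuffle_u v')
    end.

Lemma wshuffle0s v : wshuffle [::] v = [:: v].
Proof. by case: v. Qed.

Lemma wshuffles0 u : wshuffle u [::] = [:: u].
Proof. by case: u. Qed.

Lemma wshuffle_cons a u b v :
  wshuffle (a :: u) (b :: v) =
  map (cons a) (wshuffle u (b :: v)) ++ map (cons b) (wshuffle (a :: u) v).
Proof. by []. Qed.

Lemma wshuffle_ind (P : seq T -> seq T -> Prop) :
  (forall v, P [::] v) -> (forall u, P u [::]) ->
  (forall a u b v, P u (b :: v) -> P (a :: u) v -> P (a :: u) (b :: v)) ->
  forall u v, P u v.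
Proof.
move=> h0s hs0 hc; elim=> [//|a u ihu]; elim=> [//|b v ihv].
by apply: hc.
Qed.

Lemma mem_wshuffle u v s : uniq (u ++ v) ->
  (s \in wshuffle u v) =
  [&& size s == (size u + size v)%N, subseq u s & subseq v s].
Proof.
move: s; elim/wshuffle_ind: u / v => [v|u|a u b v ihu ihv] s.
- rewrite wshuffle0s inE sub0seq /= add0n => _.
  apply/eqP/andP => [->|[/eqP sz sub]]; first by rewrite subseq_refl eqxx.
  by apply/esym/eqP; rewrite -(size_subseq_leqif sub) sz.
- rewrite wshuffles0 inE sub0seq andbT addn0 => _.
  apply/eqP/andP => [->|[/eqP sz sub]]; first by rewrite subseq_refl eqxx.
  by apply/esym/eqP; rewrite -(size_subseq_leqif sub) sz.
move=> uniq_uv.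
have uniq_u : uniq (u ++ b :: v) by case/andP: uniq_uv.
have uniq_v : uniq ((a :: u) ++ v).
  by apply: subseq_uniq uniq_uv; rewrite cat_subseq // subseq_cons.
have ab : a != b.
  by case/andP: uniq_uv; rewrite mem_cat inE !negb_or => /and3P[].
rewrite wshuffle_cons mem_cat; case: s => [|c s].
  by apply/negP => /orP[] /mapP[].
have mem_cons d l : (c :: s \in map (cons d) l) = (c == d) && (s \in l).
  apply/mapP/andP => [[t tl [-> ->]]|[/eqP-> sl]]; first by rewrite eqxx.
  by exists s.
rewrite !mem_cons ihu// ihv// ![subseq _ (c :: s)]/= ![size (_ :: _)]/=.
rewrite !addSn !addnS !eqSS.
have [<-|ca] := eqVneq a c; first by rewrite (eq_sym b) (negPf ab) orbF.
have [_|_] := eqVneq b c; first by [].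
(* If [c] is neither first letter, both words are subsequences of the tail [s], which is one letter
   too short to hold them. *)
rewrite /=; apply/esym/negP => /and3P[/eqP sz sau sbv].
have sub : {subset (a :: u) ++ b :: v <= s}.
  by move=> x; rewrite mem_cat => /orP[]; apply: mem_subseq.
by have := uniq_leq_size uniq_uv sub; rewrite size_cat sz /= addSn addnS ltnn.
Qed.

Lemma wshuffle_uniq u v : uniq (u ++ v) -> uniq (wshuffle u v).
Proof.
elim/wshuffle_ind: u / v => [v|u|a u b v ihu ihv] uniq_uv.
- by rewrite wshuffle0s.
- by rewrite wshuffles0.
have uniq_u : uniq (u ++ b :: v) by case/andP: uniq_uv.
have uniq_v : uniq ((a :: u) ++ v).
  by apply: subseq_uniq uniq_uv; rewrite cat_subseq // subseq_cons.
have ab : a != b.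
  by case/andP: uniq_uv; rewrite mem_cat inE !negb_or => /and3P[].
have inj c : injective (@cons T c) by move=> x y [].
rewrite wshuffle_cons cat_uniq !map_inj_uniq ?ihu ?ihv//= andbT.
apply/hasPn => _ /mapP[s _ ->]; apply/negP => /mapP[t _ [ba _]].
by rewrite ba eqxx in ab.
Qed.

End WordShuffle.

Lemma shuffles_wshuffle (pi sigma : permutation) : disjoint_perm pi sigma ->
  perm_eq (map letters (shuffles pi sigma)) (wshuffle pi sigma).
Proof.
move=> dj; have uniq_ps := disjoint_cat_uniq dj.
apply: uniq_perm; rewrite ?wshuffle_uniq ?map_inj_uniq ?shuffles_uniq//.
  exact: val_inj.
move=> s; rewrite mem_wshuffle//; apply/mapP/idP => [[tau + ->]|].
  by rewrite mem_shuffles.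
move=> ms; have [/eqP sz sp ss] := and3P ms.
(* By size, [s] uses exactly the letters of [pi] and [sigma]; it inherits their distinctness and
   positivity and so is a [permutation]. *)
have perm_s : perm_eq (letters pi ++ letters sigma) s.
  have sub : {subset letters pi ++ letters sigma <= s}.
    by move=> a; rewrite mem_cat => /orP[]; apply: mem_subseq.
  have le_sz : (size s <= size (letters pi ++ letters sigma))%N.
    by rewrite size_cat sz.
  have [_ e] := uniq_min_size uniq_ps sub le_sz.
  by apply: uniq_perm => //; apply: leq_size_uniq le_sz.
have us : uniq s && all (fun a => 0 < a)%N s.
  rewrite -(perm_uniq perm_s) uniq_ps/=; apply/allP => a.
  rewrite -(perm_mem perm_s) mem_cat => /orP[] /permutation_gt0//.
by exists (Permutation us); rewrite ?mem_shuffles.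
Qed.

(** * Descents and the multiplicative count *)

(** The letter [a] stands in front of [w], which makes the count recursive; [a = 0] creates no
    descent in front, whence [des_desr]. *)
Fixpoint desr (a : nat) (w : seq nat) : nat :=
  if w is b :: w' then ((b < a)%N + desr b w')%N else 0%N.

Lemma desr_size a w : (desr a w <= size w)%N.
Proof. by elim: w a => //= b w ih a; have := ih b; case: (b < a)%N; lia. Qed.

Lemma des_desr (pi : permutation) : des pi = desr 0 pi.
Proof.
rewrite /= /des_fun -sum1_card big_mkcond /=.
case: (letters pi) => [|a w] /=; first by rewrite big_ord0.
rewrite add0n; elim: w a => [|b w ih] a /=; first by rewrite big_ord0.
by rewrite big_ord_recl /= inE -ih.
Qed.

Lemma des_bound (pi : permutation) : (des pi <= (size pi).-1)%N.
Proof.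
rewrite des_desr; case: (letters pi) => // a w.
by rewrite /= add0n desr_size.
Qed.

Lemma desr_iota a k m : (a < k)%N -> desr a (iota k m) = 0%N.
Proof.
elim: m a k => //= m ih a k ak; rewrite ih// addn0.
by rewrite ltnNge ltnW.
Qed.

Lemma desr_staircase d a k m : (d < a)%N -> (a < k)%N ->
  desr a (rev (iota 1 d) ++ iota k m) = d.
Proof.
elim: d a => [|d ih] a da ak; first by rewrite desr_iota.
rewrite -(addn1 d) iotaD rev_cat /= add1n addn1 ih ?ltnSn//; last first.
  exact: ltn_trans ak.
by rewrite da.
Qed.

(** The witness is [d+1, d, ..., 1, d+2, ..., n+1], which descends exactly at its first [d]
    positions. *)
Lemma permutation_with_des n d : (d <= n)%N ->
  exists2 pi : permutation, size pi = n.+1 & des pi = d.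
Proof.
move=> dn; pose w := rev (iota 1 d.+1) ++ iota d.+2 (n - d).
have pw : perm_eq w (iota 1 n.+1).
  have -> : n.+1 = (d.+1 + (n - d))%N by rewrite addSn subnKC.
  by rewrite iotaD add1n perm_cat2r perm_rev.
have wP : uniq w && all (fun a => 0 < a)%N w.
  rewrite (perm_uniq pw) iota_uniq (perm_all _ pw) /=.
  by apply/allP => a; rewrite mem_iota => /andP[/ltnW].
exists (Permutation wP); first by rewrite /= (perm_size pw) size_iota.
rewrite des_desr /= /w -(addn1 d) iotaD rev_cat /=.
by rewrite desr_staircase ?add1n ?addn1.
Qed.

(* The number of weakly increasing sequences of length [size w] with values
   among [p] consecutive values which, after a letter [a] placed on the smallest
   one, increase strictly at each descent of [a :: w]: either the first letter
   of [w] is placed on the smallest value too, or that value is discarded, in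
   which case the previous letter no longer matters and is reset to [0]. *)
Fixpoint pcount (p : nat) : nat -> seq nat -> nat :=
  if p is p'.+1 then
    fix pcount_p a w :=
      if w is b :: w' then
        ((a <= b)%N * pcount_p b w' + pcount p' 0 w)%N
      else 1%N
  else fun _ w => nilp w.

Lemma pcount_cons p a b w :
  pcount p.+1 a (b :: w) =
  ((a <= b)%N * pcount p.+1 b w + pcount p 0 (b :: w))%N.
Proof. by []. Qed.

(** By induction on [p] and then on the two words. If the first letters [b] and [c] both go on the
    smallest value, the merged sequence must list the smaller of them first, so this term of the
    product is matched by exactly one of the two ways to start a shuffle. *)
Lemma pcount_wshuffle p a u v : uniq (u ++ v) ->
  (\sum_(s <- wshuffle u v) pcount p a s = pcount p a u * pcount p a v)%N.
Proof.
elim: p a u v => [|p ihp] a u v; move: a;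
  elim/wshuffle_ind: u / v => [v|u|b u c v ihu ihv] a.
- by rewrite wshuffle0s big_seq1 mul1n.
- by rewrite wshuffles0 big_seq1 muln1.
- move=> _; rewrite wshuffle_cons big1_seq//= => s; rewrite mem_cat.
  by case/orP => /mapP[t _ ->].
- by rewrite wshuffle0s big_seq1 mul1n.
- by rewrite wshuffles0 big_seq1 muln1.
move=> uniq_uv.
have uniq_u : uniq (u ++ c :: v) by case/andP: uniq_uv.
have uniq_v : uniq ((b :: u) ++ v).
  by apply: subseq_uniq uniq_uv; rewrite cat_subseq // subseq_cons.
have bc : b != c.
  by case/andP: uniq_uv; rewrite mem_cat inE !negb_or => /and3P[].
(* The terms stand for [b] first on the smallest value, [c] first on it, and the smallest value
   discarded. The last one falls under the induction on [p]. *)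
have split_sum : (\sum_(s <- wshuffle (b :: u) (c :: v)) pcount p.+1 a s =
    (a <= b) * (pcount p.+1 b u * pcount p.+1 b (c :: v)) +
    (a <= c) * (pcount p.+1 c (b :: u) * pcount p.+1 c v) +
    pcount p 0 (b :: u) * pcount p 0 (c :: v))%N.
  rewrite -ihp// wshuffle_cons !big_cat !big_map /=.
  rewrite -ihu// -ihv// !big_distrr /= addnACA -!big_split /=.
  by [].
rewrite split_sum !pcount_cons; case: (ltngtP b c) bc => // h _;
  case: (leqP a b) => h1; case: (leqP a c) => h2;
  rewrite ?mul1n ?mul0n ?add0n; first [by ring | by lia].
Qed.

(** For [a <= b] the recursion is Pascal's rule. For [b < a] only the summand with one value fewer
    remains, and the additional descent counted by [desr] accounts for the lost value. *)
Lemma pcountE p a w :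
  pcount p a w = 'C(p + size w - (desr a w).+1, size w).
Proof.
elim: p a w => [|p ihp] a w.
  by case: w => [//|b w]; rewrite bin_small// add0n ltn_subrL.
elim: w a => [|b w ihw] a; first by rewrite bin0.
rewrite pcount_cons ihp ihw /=.
have := desr_size b w; set d := desr b w; set n := size w => dn.
rewrite !addnS add0n !addSn !subSS.
case: (ltnP b a) => ba; rewrite ?mul1n ?mul0n ?add0n ?add1n ?subSS//.
have -> : ((p + n).+1 - d = (p + n - d).+1)%N by lia.
by rewrite binS addnC.
Qed.

(* [binom(p - d + n - 1, n)], arranged so that no subtraction is truncated when
   [d < n]; the value for [n = d = 0] is [1], also at [p = 0]. *)
Definition dbin (n d p : nat) : nat := 'C(p + n - d.+1, n).

Lemma dbin_shuffle (pi sigma : permutation) p : disjoint_perm pi sigma ->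
  (\sum_(tau <- shuffles pi sigma) dbin (size tau) (des tau) p =
   dbin (size pi) (des pi) p * dbin (size sigma) (des sigma) p)%N.
Proof.
move=> dj; have dbinE (tau : permutation) :
  dbin (size tau) (des tau) p = pcount p 0 tau by rewrite des_desr pcountE.
rewrite !dbinE -pcount_wshuffle ?disjoint_cat_uniq//.
rewrite -(perm_big _ (shuffles_wshuffle dj)) big_map.
by apply: eq_bigr => tau _; rewrite dbinE.
Qed.

(** * Independence of the counts and shuffle-compatibility of [des] *)

Lemma dbin_diag n d : dbin n d d.+1 = 1%N.
Proof. by rewrite /dbin addSn subSS addnC addnK binn. Qed.

Lemma dbin_gt n d e : (d < e <= n.-1)%N -> dbin n e d.+1 = 0%N.
Proof. by move=> h; rewrite /dbin bin_small //; lia. Qed.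

(* Evaluating at p = d + 1 gives a unitriangular system. *)
Lemma dbin_free n (c : nat -> rat) :
  (forall p, \sum_(d < n.-1.+1) c d * (dbin n d p)%:R = 0) ->
  forall d, (d <= n.-1)%N -> c d = 0.
Proof.
move=> h; elim/ltn_ind => d ih dn; have dn' : (d < n.-1.+1)%N by [].
have := h d.+1; rewrite (bigD1 (Ordinal dn')) //= dbin_diag mulr1.
rewrite big1 ?addr0// => e; rewrite -val_eqE /= neq_ltn => /orP[ed|de].
  by rewrite ih ?mul0r// (leq_trans (ltnW ed)).
by rewrite dbin_gt ?mulr0// de -ltnS ltn_ord.
Qed.

(** Grouping by value gives the form required by [dbin_free]. The range [n.-1.+1] keeps the value
    [0] when [n = 0]. *)
Lemma sum_dbin_count n p (l : seq nat) : all (fun d => d <= n.-1)%N l ->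
  (\sum_(d <- l) dbin n d p)%:R =
  \sum_(d < n.-1.+1) (count_mem (d : nat) l)%:R * (dbin n d p)%:R :> rat.
Proof.
elim: l => [_|e l ih /= /andP[en ln]].
  by rewrite big_nil big1// => d _; rewrite mul0r.
rewrite big_cons natrD ih//.
under [RHS]eq_bigr do rewrite natrD mulrDl.
rewrite big_split /=; congr (_ + _).
have en' : (e < n.-1.+1)%N by [].
rewrite (bigD1 (Ordinal en')) //= eqxx mul1r big1 ?addr0// => d.
by rewrite -val_eqE /= eq_sym => /negPf->; rewrite mul0r.
Qed.

Lemma des_shuffle_compatible : shuffle_compatible des.
Proof.
move=> pi sigma pi' sigma' dj dj' d1 d2 s1 s2.
set n := (size pi + size sigma)%N.
have sizeE tau : tau \in shuffles pi sigma -> size tau = n.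
  by rewrite mem_shuffles// => /andP[/eqP].
have sizeE' tau : tau \in shuffles pi' sigma' -> size tau = n.
  by rewrite mem_shuffles// -s1 -s2 => /andP[/eqP].
have bound : all (fun d => d <= n.-1)%N (map des (shuffles pi sigma)).
  by apply/allP => _ /mapP[tau /sizeE <- ->]; apply: des_bound.
have bound' : all (fun d => d <= n.-1)%N (map des (shuffles pi' sigma')).
  by apply/allP => _ /mapP[tau /sizeE' <- ->]; apply: des_bound.
have eq_sum p : (\sum_(d <- map des (shuffles pi sigma)) dbin n d p =
                 \sum_(d <- map des (shuffles pi' sigma')) dbin n d p)%N.
  rewrite !big_map.
  transitivity (\sum_(tau <- shuffles pi sigma) dbin (size tau) (des tau) p)%N.
    by apply: eq_big_seq => tau /sizeE->.
  rewrite dbin_shuffle// s1 s2 d1 d2 -dbin_shuffle//.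
  by apply: eq_big_seq => tau /sizeE'->.
set l := map _ _ in bound eq_sum *; set l' := map _ _ in bound' eq_sum *.
(* [perm_eq] compares multiplicities only at values occurring in one of the lists, and these obey
   the bound. *)
apply/allP => d; rewrite mem_cat => /orP dl.
have dn : (d <= n.-1)%N by case: dl; [move/(allP bound)|move/(allP bound')].
(* The differences of multiplicities solve the homogeneous system of [dbin_free], since both lists
   have the same weighted sums. *)
pose c e : rat := (count_mem e l)%:R - (count_mem e l')%:R.
suff /(_ d dn)/eqP : forall e, (e <= n.-1)%N -> c e = 0.
  by rewrite subr_eq0 eqr_nat.
apply: dbin_free => p; under eq_bigr do rewrite mulrBl.
by rewrite sumrB -!sum_dbin_count// eq_sum subrr.
Qed.

(** * Spans and algebra morphisms from the shuffle algebra *)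

Section Span.
Variables (R : nzRingType) (V : lmodType R).
Implicit Types (S W : set V) (v w : V).

Lemma lspan_gen S v : S v -> lspan S v.
Proof.
move=> Sv; exists 1%N, (fun=> 1), (fun=> v); split=> //.
by rewrite big_ord1 scale1r.
Qed.

Lemma lspan0 S : lspan S 0.
Proof.
by exists 0%N, (fun=> 0), (fun=> 0); split=> [[]//|]; rewrite big_ord0.
Qed.

Lemma lspanP S a v w : lspan S v -> lspan S w -> lspan S (a *: v + w).
Proof.
move=> [m [c [s [Ss ->]]]] [m' [c' [s' [Ss' ->]]]].
exists (m + m')%N,
  (fun i : 'I_(m + m') =>
     match fintype.split i with inl j => a * c j | inr j => c' j end),
  (fun i : 'I_(m + m') =>
     match fintype.split i with inl j => s j | inr j => s' j end).
split=> [i|]; first by case: (fintype.split i).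
rewrite big_split_ord /= scaler_sumr; congr (_ + _); apply: eq_bigr => i _.
  by rewrite (unsplitK (inl i)) scalerA.
by rewrite (unsplitK (inr i)).
Qed.

Lemma lspanZ S a v : lspan S v -> lspan S (a *: v).
Proof. by move=> /(lspanP a)/(_ (lspan0 S)); rewrite addr0. Qed.

Lemma lspanD S v w : lspan S v -> lspan S w -> lspan S (v + w).
Proof. by move=> /(lspanP 1) h /h; rewrite scale1r. Qed.

Lemma lspan_sum S (I : Type) (r : seq I) (P : pred I) (F : I -> V) :
  (forall i, P i -> lspan S (F i)) -> lspan S (\sum_(i <- r | P i) F i).
Proof. by move=> h; apply: big_ind => //; [exact: lspan0|exact: lspanD]. Qed.

Lemma lspan_min S W :
  W 0 -> (forall a v w, W v -> W w -> W (a *: v + w)) -> (S `<=` W)%classic ->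
  (lspan S `<=` W)%classic.
Proof.
move=> W0 WP SW _ [m [c [s [Ss ->]]]]; elim/big_rec: _ => // i x _ Wx.
exact: WP (SW _ (Ss i)) Wx.
Qed.

Lemma lspan_sub S S' : (S `<=` lspan S')%classic ->
  (lspan S `<=` lspan S')%classic.
Proof. by apply: lspan_min; [exact: lspan0 | exact: lspanP]. Qed.

End Span.

(** Replaces a direct check that the spans are closed under products: each of them is identified
    with the image of a morphism. *)
Lemma range_subalgebra (R : nzRingType) (A B : algType R)
  (f : {lrmorphism A -> B}) : is_subalgebra (range f).
Proof.
split.
- by rewrite inE; exists 1; rewrite ?rmorph1.
- move=> a x y; rewrite !inE => -[u _ <-] [v _ <-].
  by exists (a *: u + v); rewrite // linearP.
- move=> x y; rewrite !inE => -[u _ <-] [v _ <-].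
  by exists (u * v); rewrite // rmorphM.
Qed.

Section ShuffleMorphism.
Variables (T : eqType) (st : statistic T) (sc : shuffle_compatible st).

Lemma shuffle_algebra_ind (P : shuffle_algebra sc -> Prop) :
  (forall pi, P (pclass sc pi)) -> P 0 ->
  (forall a u v, P u -> P v -> P (a *: u + v)) -> forall u, P u.
Proof. exact: shuffle_space_ind. Qed.

Lemma range_shuffle_lrmorphism (A : algType rat)
  (f : {lrmorphism shuffle_algebra sc -> A}) :
  range f = lspan (range (fun pi => f (pclass sc pi))).
Proof.
apply/seteqP; split=> [_ [u _ <-]|].
  elim/shuffle_algebra_ind: u => [pi||a u v hu hv].
  - by apply: lspan_gen; exists pi.
  - by rewrite raddf0; apply: lspan0.
  - by rewrite linearP; apply: lspanP.
apply: lspan_min => [|a _ _ [u _ <-] [v _ <-]|_ [pi _ <-]].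
- by exists 0; rewrite ?raddf0.
- by exists (a *: u + v); rewrite ?linearP.
- by exists (pclass sc pi).
Qed.

(** [linext] evaluates [g] at the chosen representative of a class; constancy of [g] on classes
    makes that choice immaterial. *)
Lemma pclass_linext (A : lmodType rat) (g : permutation -> A) :
  (forall pi sigma : permutation, size pi = size sigma -> st pi = st sigma ->
     g pi = g sigma) ->
  forall pi, linext (fun k => g (stat_class_repr k)) (pclass sc pi) = g pi.
Proof.
move=> g_class pi; rewrite /pclass /basis_class linextU.
have [sz e] : size (stat_class_repr (stat_class_of st pi)) = size pi /\
    st (stat_class_repr (stat_class_of st pi)) = st pi.
  by apply/stat_class_eqP; rewrite stat_class_reprK.
exact: g_class.
Qed.

Lemma mulr_linearl (R : nzRingType) (A : algType R) a (x y z : A) :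
  (a *: x + y) * z = a *: (x * z) + y * z.
Proof. by rewrite mulrDl scalerAl. Qed.

Lemma mulr_linearr (R : nzRingType) (A : algType R) a (x y z : A) :
  x * (a *: y + z) = a *: (x * y) + x * z.
Proof. by rewrite mulrDr scalerAr. Qed.

(** Both sides of the product rule are bilinear, so it suffices to compare them on two classes, and
    shifting letters makes the representatives disjoint. *)
Lemma shuffle_monoid_morphism (A : algType rat)
  (f : {linear shuffle_algebra sc -> A}) :
  f 1 = 1 ->
  (forall pi sigma : permutation, disjoint_perm pi sigma ->
    f (pclass sc pi) * f (pclass sc sigma) =
    \sum_(tau <- shuffles pi sigma) f (pclass sc tau)) ->
  monoid_morphism f.
Proof.
move=> f1 fM; split=> // u v.
elim/shuffle_algebra_ind: u => [pi||a u w hu hw].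
- elim/shuffle_algebra_ind: v => [sigma||a v w hv hw].
  + pose sg := shift (max_letter pi) sigma.
    have -> : pclass sc sigma = pclass sc sg.
      by apply/esym/pclass_eqP/stat_class_eqP/shift_equiv.
    have dj : disjoint_perm pi sg by apply: disjoint_shift.
    by rewrite fM // -raddf_sum -pclassM.
  + by rewrite mulr0 raddf0 mulr0.
  + rewrite [RHS](congr1 ( *%R _) (linearP f a v w)) [RHS]mulr_linearr -hv -hw.
    exact: etrans (congr1 f (mulr_linearr a _ v w)) (linearP f a _ _).
- by rewrite mul0r raddf0 mul0r.
- rewrite [RHS](congr1 ( *%R^~ _) (linearP f a u w)) [RHS]mulr_linearl -hu -hw.
  exact: etrans (congr1 f (mulr_linearl a u w _)) (linearP f a _ _).
Qed.

Lemma shuffle_lrmorphism (A : algType rat) (g : permutation -> A) :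
  (forall pi sigma : permutation, size pi = size sigma -> st pi = st sigma ->
     g pi = g sigma) ->
  g empty_permutation = 1 ->
  (forall pi sigma : permutation, disjoint_perm pi sigma ->
     g pi * g sigma = \sum_(tau <- shuffles pi sigma) g tau) ->
  exists f : {lrmorphism shuffle_algebra sc -> A},
    forall pi, f (pclass sc pi) = g pi.
Proof.
move=> g_class g1 gM.
pose f (u : shuffle_algebra sc) := linext (fun k => g (stat_class_repr k)) u.
have fE pi : f (pclass sc pi) = g pi by exact: pclass_linext.
have f_lin : linear f by exact: linext_is_linear.
pose fL : {linear shuffle_algebra sc -> A} :=
  HB.pack f (GRing.isLinear.Build rat (shuffle_algebra sc) A *:%R f f_lin).
have f_mul : monoid_morphism fL.
  apply: shuffle_monoid_morphism => [|pi sigma dj].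
    by rewrite -pclass1 [LHS]fE.
  rewrite [fL (pclass sc pi)]fE [fL (pclass sc sigma)]fE gM//.
  by apply: eq_bigr => tau _; rewrite [RHS]fE.
pose fLR : {lrmorphism shuffle_algebra sc -> A} :=
  HB.pack f (GRing.isLinear.Build rat (shuffle_algebra sc) A *:%R f f_lin)
    (GRing.isMonoidMorphism.Build (shuffle_algebra sc) A f f_mul).
by exists fLR.
Qed.

End ShuffleMorphism.

(** * Descent polynomials and series *)

Lemma ps_exp_tE j n : ps_exp ps_t j n = (n == j)%:R.
Proof.
elim: j n => [//|j ih] n; rewrite /ps_exp iterS -/(ps_exp ps_t j) /ps_mul.
case: n => [|n]; first by rewrite big_ord1 mul0r.
rewrite big_ord_recl mul0r add0r big_ord_recl mul1r /= subSS subn0 ih.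
by rewrite big1 ?addr0// => i _; rewrite mul0r.
Qed.

(** Multiplication by [1/(1-t)] takes partial sums, so the induction step is the hockey-stick
    identity, proved by Pascal's rule after reversing the sum. *)
Lemma ps_exp_inv_1mtE k n : ps_exp ps_inv_1mt k.+1 n = 'C(n + k, k)%:R.
Proof.
elim: k n => [|k ih] n; rewrite /ps_exp iterS -/(ps_exp ps_inv_1mt _) /ps_mul.
  rewrite bin0 big_ord_recr /= subnn mulr1 big1 ?add0r// => i _.
  by rewrite mul1r /ps_one subn_eq0 leqNgt ltn_ord.
under eq_bigr do rewrite mul1r ih.
rewrite (reindex_inj rev_ord_inj) /=.
under eq_bigr => i _ do rewrite subSS subKn ?leq_ord//.
elim: n => [|n ihn]; first by rewrite big_ord1 !add0n !binn.
by rewrite big_ord_recr /= ihn -natrD addSn addnS -addSnnS binS.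
Qed.

Lemma ps_frac_bin j k n : ps_frac j k.+1 n = (j <= n)%:R * 'C(n - j + k, k)%:R.
Proof.
rewrite /ps_frac /ps_mul.
under eq_bigr do rewrite ps_exp_tE ps_exp_inv_1mtE.
case: leqP => [jn|nj]; last first.
  rewrite mul0r big1// => i _.
  by rewrite ltn_eqF ?mul0r// (leq_ltn_trans (leq_ord i)).
have jn' : (j < n.+1)%N by [].
rewrite (bigD1 (Ordinal jn')) //= eqxx big1 ?addr0// => i.
by rewrite -val_eqE /= => /negPf->; rewrite mul0r.
Qed.

(** The coefficient of [t^p] is the count for [p]; the Hadamard product thus multiplies counts for
    the same [p]. *)
Definition dbin_series (n d : nat) : nat -> rat := fun p => (dbin n d p)%:R.

Lemma dbin_series0 : dbin_series 0 0 = ps_frac 0 1.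
Proof.
by apply/funext => p; rewrite ps_frac_bin /dbin_series /dbin !bin0 mulr1.
Qed.

Lemma dbin_seriesS n d : (d <= n)%N ->
  dbin_series n.+1 d = ps_frac d.+1 n.+2.
Proof.
move=> dn; apply/funext => p; rewrite ps_frac_bin /dbin_series /dbin.
case: ltnP => [dp|pd]; last by rewrite mul0r bin_small//; lia.
by rewrite mul1r; congr ('C(_, _)%:R); lia.
Qed.

Lemma prodr_ffact (R : comNzRingType) m n :
  \prod_(i < n) (m%:R - i%:R) = (m ^_ n)%:R :> R.
Proof.
elim: n => [|n ih]; first by rewrite big_ord0.
rewrite big_ord_recr /= ih ffactnSr natrM; have [nm|mn] := leqP n m.
  by rewrite natrB.
by rewrite ffact_small// !mul0r.
Qed.

(** The univariate form of [binom_p], whose identities can be tested at natural numbers; [binom_pE]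
    carries them back to two variables. *)
Definition dbin_poly (n d : nat) : {poly rat} :=
  binomial_of ('X - d%:R + n%:R - 1) n.

(** For [n > 0] the bound on [d] makes the subtraction in [dbin] exact, even at [p = 0]; for [n = 0]
    both sides are [1]. *)
Lemma dbin_poly_horner n d p : (d <= n.-1)%N ->
  (dbin_poly n d).[p%:R] = (dbin n d p)%:R.
Proof.
move=> dn; rewrite /dbin_poly /binomial_of hornerZ horner_prod /dbin.
case: n dn => [|n] dn; first by rewrite big_ord0 bin0 invr1 mulr1.
have -> : \prod_(i < n.+1) ('X - d%:R + n.+1%:R - 1 - i%:R).[p%:R] =
          \prod_(i < n.+1) ((p + n.+1 - d.+1)%N%:R - i%:R) :> rat.
  apply: eq_bigr => i _; rewrite -!polyC_natr !hornerE natrB; last by lia.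
  by rewrite natrD -(addn1 d) natrD; ring.
rewrite prodr_ffact -bin_ffact natrM mulrC mulfK// pnatr_eq0.
by rewrite -lt0n fact_gt0.
Qed.

(** A nonzero polynomial has fewer distinct roots than its size, so the natural numbers below
    [size (q - r)] suffice. *)
Lemma poly_nat_ext (R : numDomainType) (q r : {poly R}) :
  (forall p : nat, q.[p%:R] = r.[p%:R]) -> q = r.
Proof.
move=> h; apply/eqP; rewrite -subr_eq0; apply/eqP.
pose s : seq R := [seq i%:R | i <- iota 0 (size (q - r))].
apply: (@roots_geq_poly_eq0 _ _ s); last by rewrite size_map size_iota.
  by apply/allP => _ /mapP[i _ ->]; rewrite rootE !hornerE h subrr.
by rewrite map_inj_uniq ?iota_uniq//; move=> i j /eqP; rewrite eqr_nat => /eqP.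
Qed.

Lemma binom_pE n d : binom_p d n = horner_alg var_p (dbin_poly n d).
Proof.
rewrite /binom_p /dbin_poly /binomial_of -mul_polyC rmorphM rmorph_prod /=.
rewrite horner_algC mulr_algl; congr (_ *: _); apply: eq_bigr => i _.
by rewrite !rmorphB rmorphD rmorphB !rmorph_nat rmorph1 /= horner_algX.
Qed.

Lemma meval_horner_alg (v : 'I_2 -> rat) (q : {poly rat}) :
  (horner_alg var_p q).@[v] = q.[v ord0].
Proof.
elim/poly_ind: q => [|q c ih]; first by rewrite !rmorph0 horner0.
rewrite rmorphD rmorphM /= horner_algX horner_algC mevalD mevalM ih.
by rewrite !hornerE mevalXU mevalZ meval1 mulr1.
Qed.

Lemma binom_p_shuffle (pi sigma : permutation) : disjoint_perm pi sigma ->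
  \sum_(tau <- shuffles pi sigma) binom_p (des tau) (size tau) =
  binom_p (des pi) (size pi) * binom_p (des sigma) (size sigma).
Proof.
move=> dj; rewrite !binom_pE -rmorphM.
under eq_bigr do rewrite binom_pE.
rewrite -rmorph_sum; congr (horner_alg _ _); apply: poly_nat_ext => p.
rewrite hornerM horner_sum !dbin_poly_horner ?des_bound// -natrM.
rewrite -dbin_shuffle// natr_sum.
by apply: eq_bigr => tau _; rewrite dbin_poly_horner ?des_bound.
Qed.

Lemma dbin_series_shuffle (pi sigma : permutation) : disjoint_perm pi sigma ->
  \sum_(tau <- shuffles pi sigma) dbin_series (size tau) (des tau) =
  (dbin_series (size pi) (des pi) : hseries) *
  dbin_series (size sigma) (des sigma).
Proof.
move=> dj; apply/funext => p; rewrite hseriesM -natrM -dbin_shuffle// natr_sum.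
by rewrite fct_sumE.
Qed.

(** * Linear independence of the images of the classes *)

Lemma shuffle_algebra_linearE (T : eqType) (st : statistic T)
    (sc : shuffle_compatible st) (W : lmodType rat)
    (f : {linear shuffle_algebra sc -> W}) (g : permutation -> W) :
  (forall pi, f (pclass sc pi) = g pi) ->
  forall u : shuffle_algebra sc,
    f u = \sum_(k <- msupp u) mcoeff k u *: g (stat_class_repr k).
Proof.
move=> fE u.
have {1}-> : u =
    \sum_(k <- msupp u) mcoeff k u *: pclass sc (stat_class_repr k).
  rewrite {1}[u]monalgE; apply: eq_bigr => k _; apply/malgP => l.
  rewrite /pclass /basis_class stat_class_reprK.
  by rewrite mcoeffZ !mcoeffU mulr_natr.
rewrite raddf_sum; apply: eq_bigr => k _; rewrite -fE; exact: linearZZ.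
Qed.

Lemma des_class_free (u : shuffle_space des) :
  (forall n p, \sum_(k <- msupp u | size (stat_class_repr k) == n)
     mcoeff k u * (dbin n (des (stat_class_repr k)) p)%:R = 0) ->
  u = 0.
Proof.
move=> h; apply/malgP => k0; rewrite mcoeff0.
have [k0u|/mcoeff_outdom //] := boolP (k0 \in msupp u).
set n := size (stat_class_repr k0).
pose c d : rat := \sum_(k <- msupp u |
  (size (stat_class_repr k) == n) && (des (stat_class_repr k) == d)) mcoeff k u.
(* Length and descent number determine a class, so the sum has the single term [k0]. *)
have <- : c (des (stat_class_repr k0)) = mcoeff k0 u.
  rewrite /c -big_filter (big_rem k0) /=; last by rewrite mem_filter !eqxx.
  rewrite big_seq big1 ?addr0// => k.
  rewrite mem_rem_uniq ?filter_uniq ?fset_uniq// inE mem_filter.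
  move=> /and3P[/eqP kk0 /andP[/eqP sz /eqP e] _]; case: kk0.
  rewrite -[k]stat_class_reprK -[k0]stat_class_reprK.
  by apply/stat_class_eqP.
apply: (@dbin_free n); last exact: des_bound.
(* The classes of length [n] are regrouped by descent number; [inord] loses nothing because of
   [des_bound]. *)
move=> p; rewrite -[RHS](h n p) (partition_big
  (fun k => inord (des (stat_class_repr k)) : 'I_n.-1.+1) predT) //.
apply: eq_bigr => d _; rewrite mulr_suml.
have desE k : size (stat_class_repr k) == n ->
    (inord (des (stat_class_repr k)) == d) = (des (stat_class_repr k) == d).
  by move=> /eqP sz; rewrite -val_eqE /= inordK// ltnS -sz des_bound.
apply: eq_big => [k|k /andP[_ /eqP->]//].
by have [/desE->|] := boolP (_ == n).
Qed.

Lemma lrmorphism_injective_dbin (sc : shuffle_compatible des) (A : algType rat)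
    (f : {lrmorphism shuffle_algebra sc -> A}) :
  (forall u, f u = 0 -> forall n p,
     \sum_(k <- msupp (u : shuffle_space des) | size (stat_class_repr k) == n)
       mcoeff k u * (dbin n (des (stat_class_repr k)) p)%:R = 0) ->
  injective f.
Proof.
move=> h; apply: raddf_inj => u fu0.
by apply: des_class_free => n p; apply: h.
Qed.

Definition des_mpoly (pi : permutation) : Q[p,x] :=
  binom_p (des pi) (size pi) * var_x ^+ size pi.

(** Uniform in the length, whereas the fractions need a separate case for the empty permutation;
    [des_hseriesE] relates the two. *)
Definition des_hseries (pi : permutation) : hseries_poly :=
  hmonomial (dbin_series (size pi) (des pi)) (size pi).

Lemma des_hseriesE pi :
  des_hseries pi = if (1 <= size pi)%N
    then hmonomial (ps_frac (des pi).+1 (size pi).+1) (size pi)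
    else hmonomial (ps_frac 0 1) 0.
Proof.
rewrite /des_hseries; have := des_bound pi; set d := des pi.
case: (size pi) => [|n] /= dn; last by rewrite dbin_seriesS.
by move: dn; rewrite leqn0 => /eqP->; rewrite dbin_series0.
Qed.

Lemma des_mpolyM (pi sigma : permutation) : disjoint_perm pi sigma ->
  des_mpoly pi * des_mpoly sigma =
  \sum_(tau <- shuffles pi sigma) des_mpoly tau.
Proof.
move=> dj; rewrite /des_mpoly mulrACA -binom_p_shuffle// -exprD mulr_suml.
by apply: eq_big_seq => tau; rewrite mem_shuffles// => /andP[/eqP->].
Qed.

Lemma hmonomialM (a b : hseries) m n :
  hmonomial a m * hmonomial b n = hmonomial (a * b) (m + n).
Proof. by rewrite /hmonomial polyCM exprD mulrACA. Qed.

Lemma des_hseriesM (pi sigma : permutation) : disjoint_perm pi sigma ->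
  des_hseries pi * des_hseries sigma =
  \sum_(tau <- shuffles pi sigma) des_hseries tau.
Proof.
move=> dj; rewrite /des_hseries hmonomialM -dbin_series_shuffle//.
rewrite /hmonomial raddf_sum mulr_suml.
by apply: eq_big_seq => tau; rewrite mem_shuffles// => /andP[/eqP->].
Qed.

Lemma binom_p0 : binom_p 0 0 = 1.
Proof. by rewrite /binom_p /binomial_of big_ord0 invr1 scale1r. Qed.

Lemma size_des0 (pi : permutation) : size pi = 0%N -> des pi = 0%N.
Proof. by have := des_bound pi => + e; rewrite e leqn0 => /eqP. Qed.

Lemma des_empty : des empty_permutation = 0%N.
Proof. exact: size_des0. Qed.

Lemma range_des_mpoly :
  range des_mpoly = ([set 1] `|`
    [set f | exists n j : nat, (1 <= n)%N /\ (j <= n - 1)%N /\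
             f = binom_p j n * var_x ^+ n])%classic.
Proof.
apply/seteqP; split=> [_ [pi _ <-]|f].
  have [s0|s_gt0] := posnP (size pi).
    by left; rewrite /= /des_mpoly s0 size_des0// binom_p0 mulr1.
  by right; exists (size pi), (des pi); rewrite subn1 des_bound.
case=> [->|[[|n] [j [// _ [jn ->]]]]].
  by exists empty_permutation; rewrite // /des_mpoly des_empty binom_p0 mulr1.
rewrite subn1 in jn; have [pi sz e] := permutation_with_des jn.
by exists pi; rewrite // /des_mpoly sz e.
Qed.

Lemma range_des_hseries :
  range des_hseries = ([set hmonomial (ps_frac 0 1) 0] `|`
    [set f | exists n j : nat, (1 <= n)%N /\ (j <= n - 1)%N /\
             f = hmonomial (ps_frac j.+1 n.+1) n])%classic.
Proof.
apply/seteqP; split=> [_ [pi _ <-]|f].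
  rewrite des_hseriesE; case: ltnP => h; last by left.
  by right; exists (size pi), (des pi); rewrite subn1 des_bound.
case=> [->|[[|n] [j [// _ [jn ->]]]]].
  by exists empty_permutation; rewrite // des_hseriesE.
rewrite subn1 in jn; have [pi sz e] := permutation_with_des jn.
by exists pi; rewrite // des_hseriesE sz e.
Qed.

Section DescentAlgebra.
Variable sc : shuffle_compatible des.

Lemma mpoly_lrmorphism :
  exists phi : {lrmorphism shuffle_algebra sc -> Q[p,x]},
    (forall pi, phi (pclass sc pi) = des_mpoly pi) /\ injective phi.
Proof.
have [|||phi phiE] := @shuffle_lrmorphism _ _ sc Q[p,x] des_mpoly.
- by move=> pi sigma sz e; rewrite /des_mpoly sz e.
- by rewrite /des_mpoly des_empty binom_p0 mulr1.
- exact: des_mpolyM.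
exists phi; split=> //; apply: lrmorphism_injective_dbin => u phiu0 n p.
(* [q] is [phi u] at [var_p = p], as a polynomial in [var_x]; its coefficient at [n] is the required
   sum. *)
pose q : {poly rat} := \sum_(k <- msupp (u : shuffle_space des))
  (mcoeff k u *
   (dbin (size (stat_class_repr k)) (des (stat_class_repr k)) p)%:R)
    *: 'X^(size (stat_class_repr k)).
have q0 : q = 0.
  apply: poly_nat_ext => y; rewrite horner0 horner_sum.
  pose v (i : 'I_2) : rat := if i == ord0 then p%:R else y%:R.
  have phiv0 : (phi u).@[v] = 0 by rewrite phiu0 meval0.
  rewrite -[RHS]phiv0 (shuffle_algebra_linearE phiE) raddf_sum.
  apply: eq_bigr => k _.
  rewrite [RHS]mevalZ mevalM rmorphXn /= mevalXU binom_pE meval_horner_alg.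
  by rewrite hornerZ hornerXn /v eqxx dbin_poly_horner ?des_bound// mulrA.
have qn0 : q`_n = 0 by rewrite q0 coef0.
rewrite -[RHS]qn0 coef_sum big_mkcond; apply: eq_bigr => k _.
by rewrite coefZ coefXn eq_sym; case: eqP => [->|]; rewrite ?mulr1 ?mulr0.
Qed.

Lemma hseries_lrmorphism :
  exists chi : {lrmorphism shuffle_algebra sc -> hseries_poly},
    (forall pi, chi (pclass sc pi) = des_hseries pi) /\ injective chi.
Proof.
have [|||chi chiE] := @shuffle_lrmorphism _ _ sc hseries_poly des_hseries.
- by move=> pi sigma sz e; rewrite /des_hseries sz e.
(* The series [1/(1-t)] is the unit of the Hadamard product. *)
- have series1 : (dbin_series 0 0 : hseries) = 1.
    by apply/funext => p; rewrite /dbin_series /dbin bin0.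
  by rewrite /des_hseries des_empty /hmonomial mulr1 [dbin_series _ _]series1.
- exact: des_hseriesM.
exists chi; split=> //; apply: lrmorphism_injective_dbin => u chiu0 n p.
have chiu_np0 : (chi u)`_n p = 0 by rewrite chiu0 coef0.
rewrite -[RHS]chiu_np0 (shuffle_algebra_linearE chiE) coef_sum.
rewrite fct_sumE big_mkcond; apply: eq_bigr => k _; rewrite hseries_scaleE.
rewrite /des_hseries /hmonomial coefCM coefXn hseriesM eq_sym.
by case: eqP => [->|_]; rewrite ?mulr1 ?mulr0.
Qed.

End DescentAlgebra.

(** * Monomial spanning sets and dimension *)

Lemma dbin_pascal n d p : (d <= n)%N ->
  (dbin n.+1 d p + dbin n.+2 d.+1 p = dbin n.+2 d p)%N.
Proof.
move=> dn; rewrite /dbin.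
have [-> ->] : (p + n.+2 - d.+2 = p + n.+1 - d.+1)%N /\
               (p + n.+2 - d.+1 = (p + n.+1 - d.+1).+1)%N by lia.
by rewrite binS addnC.
Qed.

(** With [m = p+n-d], Pascal's rule reduces this to the absorption identity
    [(n+2) C(m,n+2) = (m-n-1) C(m,n+1)], and [(d+1) + (m-n-1) = p]. *)
Lemma dbin_mulX n d p : (d <= n)%N ->
  (p * dbin n.+1 d p =
   d.+1 * dbin n.+2 d p + (n.+1 - d) * dbin n.+2 d.+1 p)%N.
Proof.
move=> dn; rewrite -dbin_pascal// /dbin.
have -> : (p + n.+2 - d.+2 = p + n.+1 - d.+1)%N by lia.
set m := (p + n.+1 - d.+1)%N.
have absorb := mul_bin_left m n.+1.
(* Here [m - n.+1] would be truncated, but all the binomials vanish. *)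
have [mn|nm] := ltnP m n.+1; first by rewrite !bin_small ?muln0 // ltnW.
rewrite mulnDr -addnA -mulnDl.
have -> : (d.+1 + (n.+1 - d) = n.+2)%N by lia.
by rewrite absorb -mulnDl; congr muln; rewrite /m; lia.
Qed.

Lemma dbin_poly_pascal n d : (d <= n)%N ->
  dbin_poly n.+1 d = (-1) *: dbin_poly n.+2 d.+1 + dbin_poly n.+2 d.
Proof.
move=> dn; apply: poly_nat_ext => p.
rewrite dbin_poly_horner// hornerD hornerZ.
rewrite !dbin_poly_horner//; last exact: leqW.
by rewrite -(dbin_pascal p dn) natrD mulN1r addrC addrK.
Qed.

Lemma dbin_poly_mulX n d : (d <= n)%N ->
  'X * dbin_poly n.+1 d =
  d.+1%:R *: dbin_poly n.+2 d + (n.+1 - d)%:R *: dbin_poly n.+2 d.+1.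
Proof.
move=> dn; apply: poly_nat_ext => p.
rewrite hornerM hornerX dbin_poly_horner// hornerD.
rewrite hornerZ dbin_poly_horner ?leqW// hornerZ dbin_poly_horner//.
by rewrite -natrM dbin_mulX// natrD !natrM.
Qed.

Lemma dbin_poly1 : dbin_poly 1 0 = 'X.
Proof.
by rewrite /dbin_poly /binomial_of big_ord1 invr1 scale1r !subr0 addrK.
Qed.

Lemma lspan_linear (R : nzRingType) (V W : lmodType R) (f : V -> W)
    (S : set V) (S' : set W) : linear f ->
  (forall v, S v -> lspan S' (f v)) -> forall v, lspan S v -> lspan S' (f v).
Proof.
move=> f_lin fS; apply: lspan_min => [|a v w fv fw|//].
  have := f_lin (-1) 0 0; rewrite scaler0 addr0 scaleN1r addNr => ->.
  exact: lspan0.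
by rewrite f_lin; apply: lspanP.
Qed.

Definition dbin_polys (n : nat) : set {poly rat} :=
  [set dbin_poly n.+1 d | d in [set d | (d <= n)%N]]%classic.

(** There is no constant monomial, since each member of [dbin_polys n] vanishes at [0]. *)
Definition mono_polys (n : nat) : set {poly rat} :=
  [set 'X^(i.+1) | i in [set i | (i <= n)%N]]%classic.

(* The span of [dbin_polys] grows with [n] by Pascal's rule, and is shifted by
   multiplication by ['X]; so it contains every ['X^i]. *)
Lemma mono_polys_lspan n : (mono_polys n `<=` lspan (dbin_polys n))%classic.
Proof.
have gen m d : (d <= m)%N -> lspan (dbin_polys m) (dbin_poly m.+1 d).
  by move=> dm; apply: lspan_gen; exists d.
elim: n => [|n ih] _ [i /= i_le <-].
  by move: i_le; rewrite leqn0 => /eqP->; rewrite expr1 -dbin_poly1; apply: gen.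
case: i i_le => [|i] i_le; last first.
  rewrite exprS; apply: (lspan_linear (S := dbin_polys n)).
  - by move=> a u v; rewrite mulrDr scalerAr.
  - move=> _ [d /= dn <-]; rewrite dbin_poly_mulX//.
    by apply: lspanP; [apply: gen; lia|apply/lspanZ/gen].
  - by apply: ih; exists i.
apply: (@lspan_linear _ _ _ id (dbin_polys n)) => //.
  move=> _ [d /= dn <-]; rewrite dbin_poly_pascal//.
  by apply: lspanP; apply: gen; lia.
by apply: ih; exists 0%N.
Qed.

Lemma size_dbin_poly n d : (size (dbin_poly n d) <= n.+1)%N.
Proof.
rewrite /dbin_poly /binomial_of (leq_trans (size_scale_leq _ _))//.
have -> : \prod_(i < n) ('X - d%:R + n%:R - 1 - i%:R) =
          \prod_(i < n) ('X - (d%:R - n%:R + 1 + i%:R)%:P) :> {poly rat}.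
  apply: eq_bigr => i _.
  by rewrite !polyCD polyCN !polyC_natr polyC1; ring.
by rewrite -big_enum /= size_prod_XsubC size_enum_ord.
Qed.

Lemma dbin_polys_lspan n : (dbin_polys n `<=` lspan (mono_polys n))%classic.
Proof.
move=> _ [d /= dn <-]; set q := dbin_poly _ _.
have q0 : q`_0 = 0.
  rewrite -horner_coef0 (dbin_poly_horner 0) //.
  by rewrite /dbin add0n bin_small // ltn_subrL.
have -> : q = \sum_(i < n.+1) q`_i.+1 *: 'X^(i.+1).
  have {1}-> : q = \poly_(i < n.+2) q`_i.
    apply/polyP => i; rewrite coef_poly; case: ltnP => // n_lt.
    by rewrite nth_default// (leq_trans (size_dbin_poly _ _)).
  by rewrite poly_def big_ord_recl q0 scale0r add0r.
apply: lspan_sum => i _; apply/lspanZ/lspan_gen; exists i => //=.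
by rewrite -ltnS.
Qed.

Lemma horner_alg_mul_linear (y : Q[p,x]) :
  linear (fun q : {poly rat} => horner_alg var_p q * y).
Proof.
move=> a q r; rewrite rmorphD -mul_polyC rmorphM /= horner_algC mulr_algl.
by rewrite mulrDl scalerAl.
Qed.

(** Each power of [var_x] is treated separately: the linear map [horner_alg_mul_linear] transports
    the univariate inclusions between [dbin_polys n] and [mono_polys n]. *)
Lemma lspan_binom_monomials :
  lspan ([set 1] `|`
    [set f | exists n j : nat, (1 <= n)%N /\ (j <= n - 1)%N /\
             f = binom_p j n * var_x ^+ n])%classic =
  lspan ([set 1] `|`
    [set f | exists n j : nat, (1 <= n)%N /\ (1 <= j <= n)%N /\
             f = var_p ^+ j * var_x ^+ n])%classic.
Proof.
apply/seteqP; split; apply: lspan_sub => f.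
  case=> [->|[[|n] [d [// _ [dn ->]]]]]; first by apply: lspan_gen; left.
  rewrite binom_pE; apply: (lspan_linear (S := mono_polys n)
    (horner_alg_mul_linear (var_x ^+ n.+1))); last first.
    by apply: dbin_polys_lspan; exists d => //=; rewrite subn1 in dn.
  move=> _ [i /= i_le <-]; apply: lspan_gen; right; exists n.+1, i.+1.
  by rewrite rmorphXn /= horner_algX.
case=> [->|[[|n] [[|j] [// _ [// j_le ->]]]]]; first by apply: lspan_gen; left.
rewrite -[var_p](horner_algX var_p) -rmorphXn.
apply: (lspan_linear (S := dbin_polys n)
  (horner_alg_mul_linear (var_x ^+ n.+1))); last first.
  by apply: mono_polys_lspan; exists j.
move=> _ [d /= d_le <-]; apply: lspan_gen; right; exists n.+1, d.
by rewrite subn1 binom_pE.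
Qed.

(** The basis consists of one class for each descent number from [0] to [n]; independence is read
    off from the coefficients in the free module. *)
Lemma homogeneous_component_dimension (sc : shuffle_compatible des) n :
  has_dimension (homogeneous_component sc n.+1) n.+1.
Proof.
have ex (j : 'I_n.+1) : exists pi : permutation, size pi = n.+1 /\ des pi = j.
  by have [|pi] := @permutation_with_des n j; [rewrite -ltnS|exists pi].
have [pi_ piE] := choice ex.
exists (fun j => pclass sc (pi_ j)); split=> [c c0 i|].
  have : mcoeff (stat_class_of des (pi_ i)) 
      (\sum_j c j *: pclass sc (pi_ j)) = 0.
    by rewrite c0 mcoeff0.
  rewrite raddf_sum (bigD1 i) //= mcoeffZ mcoeffU eqxx mulr1.
  rewrite big1 ?addr0// => j ji.
  rewrite mcoeffZ mcoeffU.
  case: eqP => [/stat_class_eqP[_ e]|]; last by rewrite mulr0.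
  by case/eqP: ji; apply: ord_inj; rewrite -(piE i).2 -(piE j).2.
congr lspan; apply/seteqP; split=> [_ [pi /= sz <-]|_ [j _ <-]]; last first.
  by exists (pi_ j) => //=; exact: (piE j).1.
have := des_bound pi; rewrite sz -ltnS => lt_d.
exists (Ordinal lt_d) => //; apply/pclass_eqP.
by rewrite sz !(piE _).1 (piE _).2.
Qed.

Theorem theorem4p6 :
  (* (a) *)
  shuffle_compatible des /\
  forall sc : shuffle_compatible des,
  (* (b) *)
  (let B : set Q[p,x] := lspan ([set 1] `|`
       [set f | exists n j : nat, (1 <= n)%N /\ (j <= n - 1)%N /\
                f = binom_p j n * var_x ^+ n])%classic in
   is_subalgebra B /\
   exists phi : {lrmorphism shuffle_algebra sc -> Q[p,x]},
     (forall pi : permutation,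
        phi (pclass sc pi) = binom_p (des pi) (size pi) * var_x ^+ size pi) /\
     iso_onto phi B) /\
  (* (c) *)
  (let C : set Q[p,x] := lspan ([set 1] `|`
       [set f | exists n j : nat, (1 <= n)%N /\ (1 <= j <= n)%N /\
                f = var_p ^+ j * var_x ^+ n])%classic in
   is_subalgebra C /\
   exists psi : {lrmorphism shuffle_algebra sc -> Q[p,x]}, iso_onto psi C) /\
  (* (d) *)
  (let D : set hseries_poly := lspan ([set hmonomial (ps_frac 0 1) 0] `|`
       [set f | exists n j : nat, (1 <= n)%N /\ (j <= n - 1)%N /\
                f = hmonomial (ps_frac j.+1 n.+1) n])%classic in
   is_subalgebra D /\
   exists chi : {lrmorphism shuffle_algebra sc -> hseries_poly},
     (forall pi : permutation,
        chi (pclass sc pi) =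
        if (1 <= size pi)%N
        then hmonomial (ps_frac (des pi).+1 (size pi).+1) (size pi)
        else hmonomial (ps_frac 0 1) 0) /\
     iso_onto chi D) /\
  (* (e) *)
  (forall n : nat, (1 <= n)%N ->
     has_dimension (homogeneous_component sc n) n).
Proof.
split=> [|sc]; first exact: des_shuffle_compatible.
have [phi [phiE phi_inj]] := mpoly_lrmorphism sc.
have [chi [chiE chi_inj]] := hseries_lrmorphism sc.
have range_phi : range phi = lspan (range des_mpoly).
  by rewrite range_shuffle_lrmorphism (funext phiE).
have range_chi : range chi = lspan (range des_hseries).
  by rewrite range_shuffle_lrmorphism (funext chiE).
split; first (rewrite -range_des_mpoly -range_phi).
  by split; [exact: range_subalgebra | exists phi].
(* The two spans coincide, so the isomorphism [phi] serves again. *)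
split; first (rewrite -lspan_binom_monomials -range_des_mpoly -range_phi).
  by split; [exact: range_subalgebra | exists phi].
split; first (rewrite -range_des_hseries -range_chi).
  split; first exact: range_subalgebra.
  by exists chi; split=> // pi; rewrite chiE des_hseriesE.
by case=> // n _; apply: homogeneous_component_dimension.
Qed.
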